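(* Let $\mathcal{A}$ be a unital $C^*$-algebra, let $a_1,a_2,\ldots,a_n\in \mathcal{A}$ ($n\ge1$) and $f\in S(\mathcal{A})$. Then for every $r\in\mathbb{N}$, $$\left| f\left(\sum_{k=1}^n a_k \right) \right|^{2r} \leq \frac{n^{2r-1}}{2}\, f \left( \sum_{k=1}^n \frac{|a_k|^{2r}+ |a^*_k|^{2r}}{2} + \sum_{k=1}^n Re(|a_k|^r|a^*_k|^r) \right).$$ Moreover, for every $r\in\mathbb{N}$, $$v^{2r}\left( \sum_{k=1}^n a_k\right) \leq \frac{n^{2r-1}}{2} \left( \left\| \sum_{k=1}^n Re(|a_k|^r|a_k^*|^r) \right\|+ \frac12 \left\| \sum_{k=1}^n (|a_k|^{2r}+ |a_k^*|^{2r} )\right\| \right).$$ In particular, for $n=1$ and every $a\in\mathcal{A}$, $$v^{2r}(a) \leq \frac12 \left\| Re(|a|^r|a^*|^r) \right\|+ \frac14 \left\| |a|^{2r}+ |a^*|^{2r} \right\|.$$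
   Context: $\mathcal{A}$ is a unital $C^*$-algebra with unit $e$. $S(\mathcal{A})$ is the set of normalized states, i.e. continuous linear functionals $f$ on $\mathcal{A}$ with $f(e)=\|f\|=1$ (equivalently, positive linear functionals with $f(e)=1$). The algebraic numerical radius of $a\in\mathcal{A}$ is $v(a)=\sup\{|f(a)|: f\in S(\mathcal{A})\}$, and $v^{s}(a)$ means $(v(a))^{s}$. $|a|=(a^*a)^{1/2}$, so $|a^*|=(aa^* )^{1/2}$. $Re(a)=\frac12(a+a^* )$. $\mathbb{N}=\{1,2,\ldots\}$. *)

(* Defs.v *)
From HB Require Import structures.
From mathcomp Require Import all_boot all_order all_algebra.
From mathcomp Require Import complex.
From mathcomp Require Import all_classical all_reals all_analysis.

Set Implicit Arguments.
Unset Strict Implicit.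
Unset Printing Implicit Defensive.

Import Order.TTheory GRing.Theory Num.Theory.
Import numFieldNormedType.Exports.
Import Normc.

Local Open Scope classical_set_scope.
Local Open Scope ring_scope.
Local Open Scope complex_scope.

(* The norm is a field of the mixin, not a [normedModType] structure on [A]:
   Hierarchy-Builder rejects a join of [algType] with [normedModType] (missing
   join with [numDomainType], which is normed over itself).
   See [normed_of] below for the corresponding normed module. *)
HB.mixin Record isCStarAlgebra (R : realType) A of GRing.Algebra R[i] A := {
  cnorm : A -> R ;
  star : A -> A ;
  cnormD : forall a b, cnorm (a + b) <= cnorm a + cnorm b ;
  cnormZ : forall (z : R[i]) a, cnorm (z *: a) = normc z * cnorm a ;
  cnorm0_eq0 : forall a, cnorm a = 0 -> a = 0 ;
  cnormM : forall a b, cnorm (a * b) <= cnorm a * cnorm b ;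
  cnorm_complete : forall u : nat -> A,
    (forall e : R, 0 < e -> exists N, forall m n,
       (N <= m)%N -> (N <= n)%N -> cnorm (u m - u n) < e) ->
    exists l : A, forall e : R, 0 < e -> exists N, forall n,
       (N <= n)%N -> cnorm (u n - l) < e ;
  starK : forall a, star (star a) = a ;
  starD : forall a b, star (a + b) = star a + star b ;
  starZ : forall (z : R[i]) a, star (z *: a) = z^* *: star a ;
  starM : forall a b, star (a * b) = star b * star a ;
  cnorm_starM : forall a, cnorm (star a * a) = cnorm a ^+ 2
}.

(* The underlying [algType] has [1 != 0], so the zero algebra (which has no
   states) is excluded. *)
#[short(type="cstarAlgType")]
HB.structure Definition CStarAlgebra (R : realType) :=
  {A of GRing.Algebra R[i] A & isCStarAlgebra R A}.

Definition normed_of (R : realType) (A : cstarAlgType R) : Type := A.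

Section NormedOf.
Variables (R : realType) (A : cstarAlgType R).

HB.instance Definition _ := GRing.Lmodule.copy (normed_of A) A.

Let norm (a : normed_of A) : R[i] := (cnorm (a : A))%:C.

Let ler_normD a b : norm (a + b) <= norm a + norm b.
Proof. by rewrite /norm -rmorphD lecR; exact: (@cnormD _ A). Qed.

Let normrZ (z : R[i]) a : norm (z *: a) = `|z| * norm a.
Proof. by rewrite /norm [cnorm _](@cnormZ _ A) rmorphM. Qed.

Let normr0_eq0 a : norm a = 0 -> a = 0.
Proof. by move=> [/(@cnorm0_eq0 _ A)]. Qed.

HB.instance Definition _ :=
  Lmodule_isNormed.Build R[i] (normed_of A) ler_normD normrZ normr0_eq0.

End NormedOf.

Section CStarAlgebraTheory.
Variables (R : realType) (A : cstarAlgType R).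
Implicit Types (a b : A) (f : {linear A -> R[i]^o}).

Definition invertible a := exists b, a * b = 1 /\ b * a = 1.

Definition spectrum a : set R[i] := [set z | ~ invertible (a - z *: 1)].

(* In [R[i]], [0 <= z] means that [z] is real and nonnegative. *)
Definition positive_elt a := star a = a /\ spectrum a `<=` [set z | 0 <= z].

(* A positive element has exactly one positive square root; [0] is the default
   value when there is no positive square root. *)
Definition csqrt a : A := xget 0 [set b | positive_elt b /\ b ^+ 2 = a].

Definition cabs a : A := csqrt (star a * a).

Definition cre a : A := 2^-1 *: (a + star a).

Definition functional_norm f : R :=
  sup [set normc (f a) | a in [set a : A | cnorm a <= 1]].

Definition is_state f :=
  [/\ continuous (f : normed_of A -> R[i]^o), f 1 = 1
    & functional_norm f = 1].

Definition numerical_radius a : R := sup [set normc (f a) | f in is_state].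

End CStarAlgebraTheory.

(* Main.v *)
(* By convexity of t^(2r) it suffices to treat a single element a, for which
   the claim reads |f(a)|^(2r) <= f((|a|^r + |a*|^r)^2) / 4.  It follows from
     |f(a)|^2 <= f(|a|) f(|a*|)     (mixed Cauchy--Schwarz inequality),
     f(b)^r <= f(b^r)               for b >= 0 (Jensen's inequality),
   the arithmetic-geometric mean inequality and f(s)^2 <= f(s^2).  The norm
   bounds are obtained from |f(x)| <= ||x|| by taking the supremum over f.
   Positivity is handled without functional calculus, by the condition that h
   is self-adjoint and ||t - h|| <= t for some real t; its agreement with the
   spectral definition needs only the Neumann series and square roots, which
   are limits of the Picard iteration y -> (x + y^2) / 2 towards 1 - sqrt(1 - x). *)
Require Import Defs.
From mathcomp Require Import all_boot all_order all_algebra.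
From mathcomp Require Import complex.
From mathcomp Require Import all_classical all_reals all_analysis.
From mathcomp Require Import ring lra.

Set Implicit Arguments.
Unset Strict Implicit.
Unset Printing Implicit Defensive.

Import Order.TTheory GRing.Theory Num.Theory.
Import numFieldNormedType.Exports.

Local Open Scope ring_scope.

Local Open Scope classical_set_scope.
Local Open Scope complex_scope.

Lemma normc_real (R : realType) (t : R) : Normc.normc t%:C = `|t|.
Proof. by rewrite /= expr0n addr0 sqrtr_sqr. Qed.

(** * Scalars, the involution and limits in norm *)

Section NormStar.
Variables (R : realType) (A : cstarAlgType R).
Implicit Types (a b x y z : A) (t s : R).

Definition scal (t : R) : A := t%:C *: 1.

Lemma scalE t : scal t = t%:C *: 1. Proof. by []. Qed.
Lemma scal0 : scal 0 = 0. Proof. by rewrite /scal rmorph0 scale0r. Qed.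
Lemma scal1 : scal 1 = 1. Proof. by rewrite /scal rmorph1 scale1r. Qed.
Lemma scalD t s : scal (t + s) = scal t + scal s.
Proof. by rewrite /scal rmorphD scalerDl. Qed.
Lemma scalN t : scal (- t) = - scal t.
Proof. by rewrite /scal rmorphN scaleNr. Qed.
Lemma scalB t s : scal (t - s) = scal t - scal s.
Proof. by rewrite scalD scalN. Qed.
Lemma scalM t s : scal (t * s) = scal t * scal s.
Proof. by rewrite /scal rmorphM -scalerAl mul1r scalerA. Qed.
Lemma scal_mull t a : scal t * a = t%:C *: a.
Proof. by rewrite /scal -scalerAl mul1r. Qed.
Lemma scal_mulr t a : a * scal t = t%:C *: a.
Proof. by rewrite /scal -scalerAr mulr1. Qed.
Lemma scalC t a : scal t * a = a * scal t.
Proof. by rewrite scal_mull scal_mulr. Qed.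

Lemma scale_half a : 2^-1%:C *: (a + a) = a.
Proof.
by rewrite scalerDr -scalerDl -rmorphD (_ : 2^-1 + 2^-1 = 1) ?rmorph1 ?scale1r //; field.
Qed.

Lemma cnorm0 : cnorm (0 : A) = 0.
Proof. by rewrite -(scale0r (0 : A)) cnormZ Normc.normc0 mul0r. Qed.

Lemma cnormN a : cnorm (- a) = cnorm a.
Proof.
by rewrite -scaleN1r cnormZ -(rmorph1 (real_complex R)) -rmorphN normc_real
  normrN1 mul1r.
Qed.

Lemma cnorm_ge0 a : 0 <= cnorm a.
Proof.
have := cnormD a (- a); rewrite subrr cnorm0 cnormN; lra.
Qed.

Lemma cnormB a b : cnorm (a - b) <= cnorm a + cnorm b.
Proof. by rewrite -[cnorm b]cnormN; exact: cnormD. Qed.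

Lemma cnorm_distC a b : cnorm (a - b) = cnorm (b - a).
Proof. by rewrite -cnormN opprB. Qed.

Lemma cnormZr t a : cnorm (t%:C *: a) = `|t| * cnorm a.
Proof. by rewrite cnormZ normc_real. Qed.

Lemma star0 : star (0 : A) = 0.
Proof. by apply: (addIr (star 0)); rewrite -starD !add0r. Qed.

Lemma starN a : star (- a) = - star a.
Proof. by apply: (addIr (star a)); rewrite -starD !addNr star0. Qed.

Lemma starB a b : star (a - b) = star a - star b.
Proof. by rewrite starD starN. Qed.

Lemma star1 : star (1 : A) = 1.
Proof.
have := starM (star 1) (1 : A); rewrite mulr1 starK mulr1.
by move=> {2}->.
Qed.

Lemma starZc (z : R[i]) a : star (z *: a) = conjc z *: star a.
Proof. exact: starZ. Qed.

Lemma starZr t a : star (t%:C *: a) = t%:C *: star a.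
Proof. by rewrite starZc conjc_real. Qed.

Lemma star_scal t : star (scal t) = scal t.
Proof. by rewrite starZr star1. Qed.

(** The C*-identity gives ||b||^2 <= ||[star b]|| ||b||, and ||b|| cancels; applying this to
    [star a] as well gives equality. *)
Lemma cnorm_star a : cnorm (star a) = cnorm a.
Proof.
suff le b : cnorm b <= cnorm (star b).
  by apply/le_anti; rewrite le andbT -{2}(starK a) le.
have := cnorm_ge0 b; rewrite le_eqVlt => /orP[/eqP <-|b0].
  exact: cnorm_ge0.
by rewrite -(ler_pM2r b0) -expr2 -cnorm_starM; exact: cnormM.
Qed.

Lemma cnorm1 : cnorm (1 : A) = 1.
Proof.
have := cnorm_starM (1 : A); rewrite star1 mulr1 => e.
have : cnorm (1 : A) != 0 by apply/eqP => /cnorm0_eq0/eqP; rewrite oner_eq0.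
by move=> n0; apply: (mulfI n0); rewrite -expr2 -e mulr1.
Qed.

Lemma cnorm_scal t : cnorm (scal t) = `|t|.
Proof. by rewrite cnormZr cnorm1 mulr1. Qed.

Lemma cnormX_le a n : cnorm (a ^+ n) <= cnorm a ^+ n.
Proof.
elim: n => [|n IH]; first by rewrite !expr0 cnorm1.
by rewrite !exprS (le_trans (cnormM _ _))// ler_wpM2l// cnorm_ge0.
Qed.

Lemma cnorm_sqr_sa a : star a = a -> cnorm (a * a) = cnorm a ^+ 2.
Proof. by move=> sa; rewrite -cnorm_starM sa. Qed.

(** Stated through real distances because [A] itself carries no topology; only [normed_of A]
    does. *)
Definition cnorm_lim (u : nat -> A) l := (fun n => cnorm (u n - l)) @ \oo --> (0 : R).

Lemma cnorm_lim_le (u : nat -> A) (v : nat -> R) l :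
  (forall n, cnorm (u n - l) <= v n) -> v @ \oo --> (0 : R) -> cnorm_lim u l.
Proof.
move=> uv v0; apply: (@squeeze_cvgr _ _ _ _ (fun=> 0) v) => //.
- by apply: nearW => n; rewrite cnorm_ge0 uv.
- exact: cvg_cst.
Qed.

Lemma cnorm_lim_cst l : cnorm_lim (fun=> l) l.
Proof. by rewrite /cnorm_lim; under eq_fun do rewrite subrr cnorm0; exact: cvg_cst. Qed.

Lemma cnorm_limD (u v : nat -> A) l m :
  cnorm_lim u l -> cnorm_lim v m -> cnorm_lim (fun n => u n + v n) (l + m).
Proof.
move=> ul vm; apply: (@cnorm_lim_le _ (fun n => cnorm (u n - l) + cnorm (v n - m))).
  by move=> n; rewrite opprD addrACA cnormD.
by rewrite -[0]addr0; exact: cvgD.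
Qed.

Lemma cnorm_limM (u v : nat -> A) l m :
  cnorm_lim u l -> cnorm_lim v m -> cnorm_lim (fun n => u n * v n) (l * m).
Proof.
move=> ul vm; apply: (@cnorm_lim_le _ (fun n =>
   cnorm (u n - l) * (cnorm (v n - m) + cnorm m) + cnorm l * cnorm (v n - m))).
  move=> n.
  have -> : u n * v n - l * m = (u n - l) * v n + l * (v n - m).
    by rewrite mulrBl mulrBr addrA subrK.
  apply: (le_trans (cnormD _ _)); apply: lerD.
    apply: (le_trans (cnormM _ _)); apply: ler_wpM2l; first exact: cnorm_ge0.
    by rewrite -{1}(subrK m (v n)) cnormD.
  exact: cnormM.
have -> : (0 : R) = 0 * (0 + cnorm m) + cnorm l * 0 by rewrite mul0r mulr0 addr0.
apply: cvgD; apply: cvgM => //; try exact: cvg_cst.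
by apply: cvgD => //; exact: cvg_cst.
Qed.

Lemma cnorm_limZ (u : nat -> A) l t :
  cnorm_lim u l -> cnorm_lim (fun n => t%:C *: u n) (t%:C *: l).
Proof.
move=> ul; have := cnorm_limM (cnorm_lim_cst (scal t)) ul.
by rewrite scal_mull; under eq_fun do rewrite scal_mull.
Qed.

Lemma cnorm_lim_star (u : nat -> A) l :
  cnorm_lim u l -> cnorm_lim (fun n => star (u n)) (star l).
Proof. by rewrite /cnorm_lim; under [in X in _ -> X]eq_fun do rewrite -starB cnorm_star. Qed.

Lemma cnorm_limS (u : nat -> A) l : cnorm_lim u l -> cnorm_lim (fun n => u n.+1) l.
Proof. by rewrite /cnorm_lim -(cvg_shiftS (fun n => cnorm (u n - l))). Qed.

Lemma cnorm_lim_bound (u : nat -> A) l M :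
  cnorm_lim u l -> (forall n, cnorm (u n) <= M) -> cnorm l <= M.
Proof.
move=> ul uM; rewrite -subr_ge0.
have h : (fun n => cnorm (u n - l) + (M - cnorm l)) @ \oo --> (0 + (M - cnorm l)).
  by apply: cvgD => //; exact: cvg_cst.
rewrite -[_ - _]add0r -(cvg_lim _ h)//; apply: limr_ge.
  by apply/cvg_ex; eexists; exact: h.
apply: nearW => n; rewrite addrCA -opprB subr_ge0.
have := uM n; have := cnormB (u n) (u n - l); rewrite opprB addrCA subrr addr0.
lra.
Qed.

Lemma cnorm_lim_unique (u : nat -> A) l m : cnorm_lim u l -> cnorm_lim u m -> l = m.
Proof.
move=> ul um; apply/subr0_eq/cnorm0_eq0/le_anti; rewrite cnorm_ge0 andbT.
have nm : cnorm_lim (fun n => (-1)%:C *: u n) ((-1)%:C *: m) by exact: cnorm_limZ.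
have := cnorm_limD ul nm.
rewrite rmorphN1 scaleN1r; under eq_fun do rewrite scaleN1r subrr.
by move/cnorm_lim_bound; apply => n; rewrite cnorm0.
Qed.

(* Domination by a bounded monotone real sequence gives completeness without summing series. *)
Lemma cnorm_lim_dominated (u : nat -> A) (s : nat -> R) M :
  (forall n, cnorm (u n.+1 - u n) <= s n.+1 - s n) -> (forall n, s n <= M) ->
  exists l, cnorm_lim u l.
Proof.
move=> us sM.
have s_nd : nondecreasing_seq s.
  apply/nondecreasing_seqP => n; rewrite -subr_ge0.
  exact: le_trans (cnorm_ge0 _) (us n).
have dom m n : (m <= n)%N -> cnorm (u n - u m) <= s n - s m.
  elim: n => [|n IH].
    by rewrite leqn0 => /eqP ->; rewrite !subrr cnorm0.
  rewrite leq_eqVlt => /orP[/eqP ->|mn]; first by rewrite !subrr cnorm0.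
  have := cnormD (u n.+1 - u n) (u n - u m); rewrite addrA subrK => /le_trans.
  apply; have := IH mn; have := us n; lra.
have cs : cvgn s by apply: nondecreasing_is_cvgn => //; exists M => _ [n _ <-].
have [|l ul] := @cnorm_complete _ A u.
  move=> e e0; move/cvgrPdist_lt : cs => /(_ (e / 2)).
  rewrite divr_gt0// => /(_ isT)[N _ HN]; exists N => m n Nm Nn.
  have := HN _ Nm; have := HN _ Nn; rewrite /= => h1 h2.
  wlog mn : m n Nm Nn h1 h2 / (n <= m)%N.
    move=> H; case/orP: (leq_total n m) => h; first exact: H.
    by rewrite cnorm_distC; exact: H.
  apply: le_lt_trans (dom _ _ mn) _.
  move: h1 h2; rewrite !ltr_norml => /andP[? ?] /andP[? ?]; lra.
exists l; apply/cvgrPdist_lt => e /ul[N HN]; exists N => // n /= Nn.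
by rewrite sub0r normrN ger0_norm ?cnorm_ge0// HN.
Qed.

End NormStar.

(** * Neumann series and square roots by iteration *)

Section SquareRoot.
Variables (R : realType) (A : cstarAlgType R).
Implicit Types (a b h x y z : A) (t s : R).

(** The partial sums of the geometric series are dominated by their real counterparts; the limit
    satisfies y = 1 + x y and commutes with x. *)
Lemma neumann x : cnorm x < 1 -> exists y, (1 - x) * y = 1 /\ y * (1 - x) = 1.
Proof.
move=> x1; set q := cnorm x; have q0 : 0 <= q := cnorm_ge0 x.
pose u n : A := \sum_(i < n) x ^+ i; pose s n : R := \sum_(i < n) q ^+ i.
have us n : cnorm (u n.+1 - u n) <= s n.+1 - s n.
  by rewrite /u /s !big_ord_recr /= ![_ + _ ^+ n]addrC !addrK cnormX_le.
have sM n : s n <= (1 - q)^-1.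
  rewrite -div1r ler_pdivlMr ?subr_gt0// mulrC /s.
  have -> : (1 - q) * \sum_(i < n) q ^+ i = 1 - q ^+ n by rewrite -opprB mulNr -subrX1 opprB.
  by rewrite gerBl exprn_ge0.
have [y uy] := cnorm_lim_dominated us sM.
have uS n : u n.+1 = 1 + x * u n.
  rewrite /u big_ord_recl expr0 mulr_sumr; congr (_ + _).
  by apply: eq_bigr => i _; rewrite -exprS.
have ux n : x * u n = u n * x.
  rewrite /u mulr_sumr mulr_suml; apply: eq_bigr => i _.
  by rewrite -exprS exprSr.
have xy := cnorm_limM (cnorm_lim_cst x) uy.
have ey : y = 1 + x * y.
  apply: cnorm_lim_unique (cnorm_limS uy) _; under eq_fun do rewrite uS.
  exact: cnorm_limD (cnorm_lim_cst 1) xy.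
have cxy : x * y = y * x.
  apply: cnorm_lim_unique xy _; under eq_fun do rewrite ux.
  exact: cnorm_limM uy (cnorm_lim_cst x).
have e1 : y - x * y = 1 by rewrite {1}ey addrK.
by exists y; rewrite mulrBl mulrBr mul1r mulr1 -cxy.
Qed.

(* The fixed points [y] satisfy [(1 - y) ^ 2 = 1 - x]. *)
Fixpoint sqrt_iter x n : A :=
  if n is m.+1 then 2^-1%:C *: (x + sqrt_iter x m * sqrt_iter x m) else 0.

(** The same iteration for the number 1; it majorizes the norms of the iterates and of their
    increments when ||x|| <= 1. *)
Fixpoint real_sqrt_iter n : R :=
  if n is m.+1 then 2^-1 * (1 + real_sqrt_iter m * real_sqrt_iter m) else 0.

(** Two parameters are allowed: equal ones give commutation, distinct ones lead to
    [cabs_intertwine]. *)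
Lemma sqrt_iter_intertwine z x x' n :
  z * x = x' * z -> z * sqrt_iter x n = sqrt_iter x' n * z.
Proof.
move=> zx; elim: n => [|n IH] /=; first by rewrite mulr0 mul0r.
by rewrite -scalerAr -scalerAl mulrDr mulrDl zx mulrA IH -!mulrA IH.
Qed.

Lemma sqrt_iter_comm x m n :
  sqrt_iter x m * sqrt_iter x n = sqrt_iter x n * sqrt_iter x m.
Proof. by apply: sqrt_iter_intertwine; apply/esym; exact: sqrt_iter_intertwine. Qed.

Lemma real_sqrt_iter_bound n : 0 <= real_sqrt_iter n <= 1.
Proof.
elim: n => [|n /andP[h0 h1]] /=; first by rewrite lexx ler01.
have r0 : 0 <= real_sqrt_iter n * real_sqrt_iter n by exact: mulr_ge0.
have r1 : real_sqrt_iter n * real_sqrt_iter n <= 1 by exact: mulr_ile1.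
by apply/andP; split; [lra|lra].
Qed.

Lemma sqrt_iter_bound x n : cnorm x <= 1 -> cnorm (sqrt_iter x n) <= real_sqrt_iter n.
Proof.
move=> x1; elim: n => [|n IH] /=; first by rewrite cnorm0.
rewrite cnormZr ger0_norm; last lra.
rewrite ler_wpM2l//.
apply: le_trans (cnormD _ _) (lerD x1 _).
by apply: le_trans (cnormM _ _) _; apply: ler_pM; rewrite ?cnorm_ge0.
Qed.

(** The iterates commute, so u^2 - v^2 factors as (u - v)(u + v), and the increments obey the
    recursion of the scalar majorant. *)
Lemma sqrt_iter_step x n : cnorm x <= 1 ->
  cnorm (sqrt_iter x n.+1 - sqrt_iter x n) <= real_sqrt_iter n.+1 - real_sqrt_iter n.
Proof.
move=> x1; elim: n => [|n IH].
  rewrite /= !mul0r !addr0 !subr0 cnormZr ger0_norm; last lra.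
  by rewrite mulr1 ler_piMr//; lra.
pose u := sqrt_iter x n.+1; pose v := sqrt_iter x n.
have -> : sqrt_iter x n.+2 - sqrt_iter x n.+1 = 2^-1%:C *: ((u - v) * (u + v)).
  have vu : v * u = u * v := sqrt_iter_comm x n n.+1.
  rewrite (_ : sqrt_iter x n.+2 = 2^-1%:C *: (x + u * u))//.
  rewrite (_ : sqrt_iter x n.+1 = 2^-1%:C *: (x + v * v))// -scalerBr.
  by rewrite opprD addrACA subrr add0r mulrBl !mulrDr vu opprD addrA addrK.
rewrite cnormZr ger0_norm; last lra.
have -> : real_sqrt_iter n.+2 - real_sqrt_iter n.+1 =
  2^-1 * ((real_sqrt_iter n.+1 - real_sqrt_iter n) *
    (real_sqrt_iter n.+1 + real_sqrt_iter n)).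
  set p := real_sqrt_iter n.+1; set q := real_sqrt_iter n.
  rewrite [LHS](_ : _ = 2^-1 * (1 + p * p) - 2^-1 * (1 + q * q))//; ring.
rewrite ler_wpM2l//.
apply: le_trans (cnormM _ _) _; apply: ler_pM; rewrite ?cnorm_ge0//.
by apply: le_trans (cnormD _ _) _; apply: lerD; exact: sqrt_iter_bound.
Qed.

Definition one_sub_sqrt x := xget 0 [set y | cnorm_lim (sqrt_iter x) y].

Lemma one_sub_sqrt_lim x : cnorm x <= 1 -> cnorm_lim (sqrt_iter x) (one_sub_sqrt x).
Proof.
move=> x1; rewrite /one_sub_sqrt; case: xgetP => [y -> //|].
have [n|n|l xl /(_ l)//] := @cnorm_lim_dominated _ _ (sqrt_iter x) real_sqrt_iter 1.
  exact: sqrt_iter_step.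
by have /andP[] := real_sqrt_iter_bound n.
Qed.

(* [scaled_sqrt t h] is the square root of [h] as soon as [cnorm (scal t - h) <= t]. *)
Definition scaled_sqrt t h : A :=
  (Num.sqrt t)%:C *: (1 - one_sub_sqrt (t^-1%:C *: (scal A t - h))).

Let cnorm_resc t h : 0 < t -> cnorm (scal A t - h) <= t ->
  cnorm (t^-1%:C *: (scal A t - h)) <= 1.
Proof.
move=> t0 th; rewrite cnormZr ger0_norm; last by rewrite invr_ge0 ltW.
by rewrite mulrC ler_pdivrMr// mul1r.
Qed.

Lemma scaled_sqrt_sqr t h : 0 < t -> cnorm (scal A t - h) <= t ->
  scaled_sqrt t h * scaled_sqrt t h = h.
Proof.
move=> t0 /(cnorm_resc t0) /one_sub_sqrt_lim; rewrite /scaled_sqrt.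
set x := t^-1%:C *: _; set y := one_sub_sqrt x => xy.
(* The recursion passes to the limit. *)
have ey : y = 2^-1%:C *: (x + y * y).
  have := cnorm_limD (cnorm_lim_cst x) (cnorm_limM xy xy).
  by move/(cnorm_limZ 2^-1); exact: cnorm_lim_unique (cnorm_limS xy).
have ey2 : y + y = x + y * y.
  by rewrite -[RHS]scale_half scalerDr -ey.
rewrite -scalerAl -scalerAr scalerA -rmorphM -expr2 sqr_sqrtr ?ltW//.
have -> : (1 - y) * (1 - y) = 1 - x.
  rewrite mulrBl mul1r mulrBr mulr1.
  by rewrite -addrA -opprD addrA ey2 addrK.
rewrite scalerBr /x scalerA -rmorphM divff ?gt_eqF// scale1r.
by rewrite opprB addrCA subrr addr0.
Qed.

Lemma scaled_sqrt_norm t h : 0 < t -> cnorm (scal A t - h) <= t ->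
  cnorm (scal A (Num.sqrt t) - scaled_sqrt t h) <= Num.sqrt t.
Proof.
move=> t0 /(cnorm_resc t0) xn; rewrite /scaled_sqrt.
set x := t^-1%:C *: _ in xn *.
rewrite /scal -scalerBr cnormZr ger0_norm ?sqrtr_ge0//.
rewrite opprB addrCA subrr addr0 ler_piMr ?sqrtr_ge0//.
apply: (cnorm_lim_bound (one_sub_sqrt_lim xn)) => n.
apply: le_trans (sqrt_iter_bound n xn) _.
by have /andP[] := real_sqrt_iter_bound n.
Qed.

Lemma scaled_sqrt_star t h : 0 < t -> cnorm (scal A t - h) <= t ->
  star h = h -> star (scaled_sqrt t h) = scaled_sqrt t h.
Proof.
move=> t0 /(cnorm_resc t0) xn hs; rewrite /scaled_sqrt.
set x := t^-1%:C *: _ in xn *.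
have xs : star x = x by rewrite starZr starB star_scal hs.
rewrite starZr starB star1; congr (_ *: (_ - _)).
have xl := one_sub_sqrt_lim xn.
apply: cnorm_lim_unique (cnorm_lim_star xl) _.
rewrite (_ : (fun n => _) = sqrt_iter x)//; apply/funext; elim=> [|n IH] /=.
  exact: star0.
by rewrite starZr starD xs starM IH.
Qed.

Lemma scaled_sqrt_intertwine t z h h' : 0 < t ->
  cnorm (scal A t - h) <= t -> cnorm (scal A t - h') <= t ->
  z * h = h' * z -> z * scaled_sqrt t h = scaled_sqrt t h' * z.
Proof.
move=> t0 /(cnorm_resc t0) xn /(cnorm_resc t0) xn' zh; rewrite /scaled_sqrt.
set x := t^-1%:C *: _ in xn *; set x' := t^-1%:C *: _ in xn' *.
have zx : z * x = x' * z.
  by rewrite -scalerAl -scalerAr mulrBl mulrBr scalC zh.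
rewrite -scalerAl -scalerAr mulrBl mulrBr mul1r mulr1; congr (_ *: (_ - _)).
apply: cnorm_lim_unique (cnorm_limM (cnorm_lim_cst z) (one_sub_sqrt_lim xn)) _.
under eq_fun do rewrite (sqrt_iter_intertwine _ zx).
exact: cnorm_limM (one_sub_sqrt_lim xn') (cnorm_lim_cst z).
Qed.

End SquareRoot.

(** * The positive cone described by the norm *)

Section NormPositive.
Variables (R : realType) (A : cstarAlgType R).
Implicit Types (a b d h k q x y z : A) (s t : R).
Local Notation scal := (scal A).

(** For self-adjoint h the bound puts the spectrum into the disc of radius t about t, hence into
    [0, 2t]. Stability under sums is then just the triangle inequality. *)
Definition npos h := star h = h /\ exists t, cnorm (scal t - h) <= t.

Lemma npos_star h : npos h -> star h = h. Proof. by case. Qed.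

(** Witnesses may be enlarged, so two elements can share one. *)
Lemma npos_witness_le h t s :
  cnorm (scal t - h) <= t -> t <= s -> cnorm (scal s - h) <= s.
Proof.
move=> ht ts; rewrite -(subrK t s) scalD -addrA; apply: le_trans (cnormD _ _) _.
by rewrite cnorm_scal ger0_norm ?subr_ge0// lerD2l.
Qed.

Lemma npos_sa h t : star h = h -> cnorm h <= t -> npos (scal t - h).
Proof.
move=> hs ht; split; first by rewrite starB star_scal hs.
by exists t; rewrite opprB addrCA subrr addr0.
Qed.

Lemma npos_scal t : 0 <= t -> npos (scal t).
Proof.
move=> t0; split; first exact: star_scal.
by exists t; rewrite subrr cnorm0.
Qed.

Lemma npos0 : npos 0. Proof. by rewrite -(scal0 A); exact: npos_scal. Qed.

Lemma npos1 : npos 1. Proof. by rewrite -(scal1 A); exact: npos_scal. Qed.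

Lemma nposD h k : npos h -> npos k -> npos (h + k).
Proof.
move=> [hs [t ht]] [ks [s ks']]; split; first by rewrite starD hs ks.
exists (t + s); rewrite scalD opprD addrACA; apply: le_trans (cnormD _ _) _.
exact: lerD.
Qed.

Lemma npos_sum (I : Type) (r : seq I) (P : pred I) (F : I -> A) :
  (forall i, P i -> npos (F i)) -> npos (\sum_(i <- r | P i) F i).
Proof.
move=> h; elim/big_ind: _ => //; [exact: npos0|exact: nposD].
Qed.

Lemma nposZ t h : 0 <= t -> npos h -> npos (t%:C *: h).
Proof.
move=> t0 [hs [s hsn]]; split; first by rewrite starZr hs.
exists (t * s); rewrite scalM scal_mull -scalerBr cnormZr ger0_norm//.
exact: ler_wpM2l.
Qed.

(** Both roots are built with the same scale [s], which lets intertwining relations pass to them. *)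
Lemma npos_sqrt2 h h' : npos h -> npos h' -> exists d d',
  [/\ npos d, npos d', d * d = h, d' * d' = h' &
      forall z, z * h = h' * z -> z * d = d' * z].
Proof.
move=> [hs [t ht]] [hs' [t' ht']]; pose s := Num.max 1 (Num.max t t').
have s0 : 0 < s by rewrite lt_max ltr01.
have hS : cnorm (scal s - h) <= s by apply: npos_witness_le ht _; rewrite !le_max lexx !orbT.
have hS' : cnorm (scal s - h') <= s by apply: npos_witness_le ht' _; rewrite !le_max lexx !orbT.
exists (scaled_sqrt s h), (scaled_sqrt s h'); split.
- split; first exact: scaled_sqrt_star.
  by exists (Num.sqrt s); exact: scaled_sqrt_norm.
- split; first exact: scaled_sqrt_star.
  by exists (Num.sqrt s); exact: scaled_sqrt_norm.
- exact: scaled_sqrt_sqr.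
- exact: scaled_sqrt_sqr.
- by move=> z; exact: scaled_sqrt_intertwine.
Qed.

Lemma npos_sqrt h : npos h -> exists d,
  [/\ npos d, d * d = h & forall z, z * h = h * z -> z * d = d * z].
Proof.
move=> hp; have [d [d' [dp _ dd _ dc]]] := npos_sqrt2 hp hp.
(* Taking z = 1 shows that the two roots of h coincide. *)
have e : d = d' by have := dc 1; rewrite !mul1r !mulr1; exact.
by exists d; split=> // z /dc ->; rewrite -e.
Qed.

(* [s = (u + star u) / 2] for the normal element [u = s + i q], and
   [star u * u = s ^ 2 + q ^ 2]. *)
Lemma cnorm_le_sum_sqr d q : star d = d -> star q = q -> d * q = q * d ->
  cnorm d ^+ 2 <= cnorm (d * d + q * q).
Proof.
move=> ds qs dq; pose u := d + 'i%C *: q.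
have us : star u = d - 'i%C *: q.
  by rewrite starD starZc ds qs -scaleNr; congr (_ + _ *: _); simpc.
have uu : star u * u = d * d + q * q.
  rewrite us /u mulrBl !mulrDr -!scalerAl -!scalerAr dq scalerA -(expr2 'i%C) sqr_i scaleN1r.
  by rewrite opprD addrA addrK opprK.
rewrite -uu cnorm_starM ler_pXn2r ?nnegrE ?cnorm_ge0//.
have -> : d = (2^-1)%:C *: (u + star u).
  by rewrite us /u addrACA subrr addr0 scale_half.
rewrite cnormZr ger0_norm; last lra.
have := cnormD u (star u); rewrite cnorm_star; lra.
Qed.

(** With t = ||d||^2 and q^2 = t - d^2, one has ||t - d^2|| = ||q||^2 <= ||q^2 + d^2|| = t. *)
Lemma npos_sqr d : star d = d -> npos (d * d).
Proof.
move=> ds; pose t := cnorm d ^+ 2.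
have dds : star (d * d) = d * d by rewrite starM ds.
have ddn : cnorm (d * d) <= t by rewrite cnorm_sqr_sa.
have [q [[qs _] qq qc]] := npos_sqrt (npos_sa dds ddn).
have dq : d * q = q * d by apply: qc; rewrite mulrBl mulrBr mulrA scalC.
split=> //; exists t; rewrite -qq.
rewrite cnorm_sqr_sa//; apply: le_trans (cnorm_le_sum_sqr qs ds (esym dq)) _.
by rewrite qq subrK cnorm_scal ger0_norm// sqr_ge0.
Qed.

(** Any bound of the norm is a witness: for commuting roots q of t - h and d of h, ||t - h|| =
    ||q||^2 <= ||q^2 + d^2|| = t. *)
Lemma npos_norm h t : npos h -> cnorm h <= t -> cnorm (scal t - h) <= t.
Proof.
move=> hp ht.
have t0 : 0 <= t by apply: le_trans ht; exact: cnorm_ge0.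
have [hs _] := hp.
have [d [[ds _] dd dc]] := npos_sqrt hp.
have [q [[qs _] qq qc]] := npos_sqrt (npos_sa hs ht).
have hd : h * d = d * h by apply: dc.
have dq : d * q = q * d by apply: qc; rewrite mulrBl mulrBr scalC hd.
rewrite -qq cnorm_sqr_sa//; apply: le_trans (cnorm_le_sum_sqr qs ds (esym dq)) _.
by rewrite qq dd subrK cnorm_scal ger0_norm.
Qed.

(** The roots d and e of h and k commute as well, so h k is the square of the self-adjoint element d
    e. *)
Lemma npos_mul h k : npos h -> npos k -> h * k = k * h -> npos (h * k).
Proof.
move=> hp kp hk.
have [d [[ds _] dd dc]] := npos_sqrt hp.
have [e [[es _] ee ec]] := npos_sqrt kp.
have de : d * e = e * d := esym (dc _ (esym (ec _ hk))).
have -> : h * k = (d * e) * (d * e) by rewrite -dd -ee -[RHS]mulrA (mulrA e) -de !mulrA.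
by apply: npos_sqr; rewrite starM ds es de.
Qed.

Lemma npos_exp h n : npos h -> npos (h ^+ n).
Proof.
move=> hp; elim: n => [|n IH]; first by rewrite expr0; exact: npos1.
by rewrite exprS; apply: npos_mul => //; exact: commrX.
Qed.

(** The roots d of h and e of -h commute and d^2 + e^2 = 0, which forces d = 0. *)
Lemma npos_anti h : npos h -> npos (- h) -> h = 0.
Proof.
move=> hp hn.
have [d [[ds _] dd dc]] := npos_sqrt hp.
have [e [[es _] ee ec]] := npos_sqrt hn.
have de : d * e = e * d by apply: ec; rewrite mulrN mulNr -dd mulrA.
have := cnorm_le_sum_sqr ds es de; rewrite dd ee subrr cnorm0 => d0.
have /eqP : cnorm d ^+ 2 = 0 by apply/le_anti; rewrite d0 sqr_ge0.
by rewrite sqrf_eq0 => /eqP/cnorm0_eq0 d00; rewrite -dd d00 mul0r.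
Qed.

(** By [npos_norm] the single witness ||h|| + 1 serves for all shifts of size at most 1, so it
    survives the limit. *)
Lemma npos_closed h : (forall e, 0 < e -> npos (h + scal e)) -> npos h.
Proof.
move=> he; have hs : star h = h.
  have [+ _] := he 1 ltr01; rewrite starD star_scal; exact: addIr.
split=> //; exists (cnorm h + 1); apply/ler_addgt0Pr => e e0.
pose d := Num.min e 1.
have d0 : 0 < d by rewrite lt_min e0 ltr01.
have hd : cnorm (h + scal d) <= cnorm h + 1.
  apply: le_trans (cnormD _ _) _; rewrite cnorm_scal gtr0_norm// lerD2l.
  by rewrite ge_min lexx orbT.
have := npos_norm (he d d0) hd; rewrite opprD addrA => hn.
rewrite -[X in cnorm X](subrK (scal d)); apply: le_trans (cnormD _ _) _.
by apply: lerD => //; rewrite cnorm_scal gtr0_norm// ge_min lexx.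
Qed.

Lemma npos_star_inv h k : star h = h -> h * k = 1 -> k * h = 1 -> star k = k.
Proof.
move=> hs hk kh; rewrite -[LHS]mulr1 -hk mulrA -{1}hs -starM hk.
by rewrite star1 mul1r.
Qed.

(** Here h + t = (s + t)(1 - x), where x = (s - h) / (s + t) has norm at most s / (s + t) < 1. *)
Lemma npos_invertible h t : npos h -> 0 < t -> invertible (h + scal t).
Proof.
move=> [hs [s hn]] t0.
have s0 : 0 <= s by apply: le_trans hn; exact: cnorm_ge0.
have st0 : 0 < s + t by lra.
pose x := ((s + t)^-1)%:C *: (scal s - h).
have x1 : cnorm x < 1.
  rewrite cnormZr gtr0_norm ?invr_gt0// mulrC ltr_pdivrMr// mul1r.
  apply: le_lt_trans hn _; lra.
have [y [xy yx]] := neumann x1.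
have e : h + scal t = (s + t)%:C *: (1 - x).
  rewrite scalerBr /x scalerA -rmorphM divff ?gt_eqF// scale1r -/(scal _).
  by rewrite scalD opprB [RHS]addrC addrA subrK.
exists (((s + t)^-1)%:C *: y); rewrite e -!scalerAl -!scalerAr !scalerA -!rmorphM.
by rewrite divff ?mulVf ?gt_eqF// !scale1r.
Qed.

Lemma invertible_comm_mul x y : invertible (x * y) -> x * y = y * x -> invertible x.
Proof.
move=> [w [xyw wxy]] xy; exists (y * w); rewrite mulrA xyw; split=> //.
have -> : y * w = w * y; last by rewrite -mulrA -xy.
have wyx : w * y * x = 1 by rewrite -mulrA -xy.
by rewrite -[LHS]mul1r -wyx -!mulrA [x * _]mulrA xyw mulr1.
Qed.

Lemma diff_squares_comm x y : y * x = x * y -> (x - y) * (x + y) = x * x - y * y.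
Proof. by move=> yx; rewrite mulrBl !mulrDr yx opprD addrA addrK. Qed.

Lemma diff_squares_comm' x y : y * x = x * y -> (x + y) * (x - y) = x * x - y * y.
Proof. by move=> yx; rewrite mulrDl !mulrBr yx addrA subrK. Qed.

Lemma npos_positive_elt h : npos h -> positive_elt h.
Proof.
move=> hp; split; first exact: npos_star.
have [hs _] := hp.
move=> [al be] /= nz; apply: contrapT => zn; apply: nz.
have ez : (al +i* be) *: (1 : A) = scal al + 'i%C *: scal be.
  by rewrite !scalE scalerA -scalerDl; congr (_ *: _); simpc.
have [b0|b0] := eqVneq be 0.
  have a0 : al < 0.
    by rewrite ltNge; apply/negP => a0; apply: zn; rewrite b0 lecE /= eqxx.
  rewrite ez b0 scal0 scaler0 addr0 -scalN; apply: npos_invertible => //.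
  by rewrite oppr_gt0.
(* Off the real axis, (k - j)(k + j) = k^2 + be^2 is a positive element plus a positive scalar,
   hence invertible, and so is its commuting factor k - j. *)
pose j : A := 'i%C *: scal be; pose k := h - scal al.
have ks : star k = k by rewrite starB hs star_scal.
have jc x : j * x = x * j by rewrite -scalerAl -scalerAr scalC.
have jj : j * j = - scal (be ^+ 2).
  by rewrite /j -scalerAl -scalerAr scalerA -(expr2 'i%C) sqr_i scaleN1r -scalM.
have -> : h - (al +i* be) *: 1 = k - j by rewrite ez opprD addrA.
apply: (@invertible_comm_mul _ (k + j)); last first.
  by rewrite diff_squares_comm // diff_squares_comm'.
rewrite diff_squares_comm // jj opprK.
apply: npos_invertible; first exact: npos_sqr.
by rewrite exprn_even_gt0.
Qed.

(* [M h - 1 = h * (M - h^-1)], where [M] is the norm of [h^-1]. *)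
Lemma npos_sub_scal h : npos h -> invertible h ->
  exists2 e, 0 < e & npos (h - scal e).
Proof.
move=> hp [k [hk kh]]; have [hs _] := hp.
have ks := npos_star_inv hs hk kh.
pose M := cnorm k + 1.
have M0 : 0 < M by rewrite ltr_wpDl// cnorm_ge0.
have kM : cnorm k <= M by rewrite lerDl.
exists M^-1; first by rewrite invr_gt0.
have -> : h - scal M^-1 = (M^-1)%:C *: (h * (scal M - k)).
  rewrite mulrBr hk scal_mulr scalerBr scalerA -rmorphM mulVf ?gt_eqF//.
  by rewrite scale1r.
apply: nposZ; first by rewrite invr_ge0 ltW.
by apply: npos_mul => //; [exact: npos_sa|rewrite mulrBr mulrBl hk kh scalC].
Qed.

(* The half-line of all [t >= 0] with [npos (b + scal t)] is closed, and it is
   open away from [0] since [b + scal t] is invertible. *)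
Lemma positive_elt_npos b : positive_elt b -> npos b.
Proof.
move=> [bs sp].
have binv t : 0 < t -> invertible (b + scal t).
  move=> t0; apply: contrapT => ni.
  have /sp : spectrum b (- t%:C) by rewrite /spectrum /= scaleNr opprK.
  by rewrite /= oppr_ge0 -(rmorph0 (real_complex R)) lecR leNgt t0.
pose S := [set t | 0 <= t /\ npos (b + scal t)].
have Sup s t : S s -> s <= t -> S t.
  move=> [s0 bsn] st; split; first exact: le_trans st.
  have -> : b + scal t = b + scal s + scal (t - s).
    by rewrite -addrA -scalD addrCA subrr addr0.
  by apply: nposD => //; apply: npos_scal; rewrite subr_ge0.
have Sn : S (cnorm b).
  split; first exact: cnorm_ge0.
  rewrite addrC -[b]opprK; apply: npos_sa; first by rewrite starN bs.
  by rewrite cnormN opprK.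
have lbS : lbound S 0 by move=> t [].
have hi : has_inf S by split; [exists (cnorm b)|exists 0].
have t0 : 0 <= inf S by apply: lb_le_inf => //; exists (cnorm b).
have bt : npos (b + scal (inf S)).
  apply: npos_closed => e e0; have [t St te] := inf_adherent e0 hi.
  rewrite -addrA -scalD; have [] := Sup _ (inf S + e) St (ltW te); done.
move: t0; rewrite le_eqVlt => /orP[/eqP t0|t0].
  by move: bt; rewrite -t0 scal0 addr0.
have [e e0 be] := npos_sub_scal bt (binv _ t0).
(* The bound d <= e preserves positivity and d <= inf S keeps the parameter nonnegative; a member of
   S below its infimum results. *)
pose d := Num.min e (inf S).
have : S (inf S - d).
  split; first by rewrite subr_ge0 ge_min lexx orbT.
  have -> : b + scal (inf S - d) = (b + scal (inf S) - scal e) + scal (e - d).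
    by rewrite !scalB !addrA subrK.
  by apply: nposD => //; apply: npos_scal; rewrite subr_ge0 ge_min lexx.
move=> /(ge_inf (ex_intro _ 0 lbS)); rewrite lerBrDr gerDl leNgt.
by rewrite lt_min e0 t0.
Qed.

End NormPositive.

(** * Positivity of [star x * x] and the modulus *)

Section ModulusTheory.
Variables (R : realType) (A : cstarAlgType R).
Implicit Types (a b c d h k l q x y z : A) (s t : R).
Local Notation scal := (scal A).

Lemma sa_sqr_eq0 x : star x = x -> x * x = 0 -> x = 0.
Proof.
move=> xs xx; apply/cnorm0_eq0/eqP; rewrite -sqrf_eq0 -cnorm_sqr_sa// xx.
by rewrite cnorm0.
Qed.

(* Jacobson: if [w] inverts [z + x y], then [z^-1 (1 - y w x)] inverts [z + y x]. *)
Lemma invertible_swap (z : R[i]) x y : z != 0 ->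
  invertible (x * y + z *: 1) -> invertible (y * x + z *: 1).
Proof.
move=> z0 [w [e1 e2]].
have e1' : x * y * w + z *: w = 1 by rewrite -e1 mulrDl -scalerAl mul1r.
have e2' : w * (x * y) + z *: w = 1 by rewrite -e2 mulrDr -scalerAr mulr1.
exists (z^-1 *: (1 - y * w * x)); rewrite -scalerAr -scalerAl.
have -> : (y * x + z *: 1) * (1 - y * w * x) = z *: 1.
  rewrite mulrBr mulr1 mulrDl -scalerAl mul1r.
  have -> : y * x * (y * w * x) + z *: (y * w * x) = y * x.
    rewrite -[in RHS](mulr1 y) -e1' mulrDr mulrDl -scalerAr -scalerAl.
    by rewrite !mulrA.
  by rewrite addrC addKr.
have -> : (1 - y * w * x) * (y * x + z *: 1) = z *: 1.
  rewrite mulrBl mul1r mulrDr -scalerAr mulr1.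
  have -> : y * w * x * (y * x) + z *: (y * w * x) = y * x.
    rewrite -[in RHS](mulr1 y) -e2' mulrDr mulrDl -scalerAr -scalerAl.
    by rewrite !mulrA.
  by rewrite addrC addKr.
by rewrite scalerA mulVf// scale1r.
Qed.

Lemma invertibleN x : invertible x -> invertible (- x).
Proof. by move=> [y [xy yx]]; exists (- y); rewrite !mulrNN. Qed.

(** The two products have the same nonzero spectrum by [invertible_swap], and z = 0 is nonnegative
    anyway. *)
Lemma npos_oppr_swap y : npos (- (star y * y)) -> npos (- (y * star y)).
Proof.
move=> /npos_positive_elt [_ sp]; apply/positive_elt_npos; split.
  by rewrite starN starM starK.
move=> z /= nz; have [->|z0] := eqVneq z 0; first exact: lexx.
apply: sp => i; apply: nz; rewrite -opprD; apply: invertibleN.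
apply: invertible_swap z0 _; rewrite -[X in invertible X]opprK opprD.
exact: invertibleN.
Qed.

Lemma sub_sqrDB x y :
  (x + y) * (x + y) - (x - y) * (x - y) = (x * y + y * x) + (x * y + y * x).
Proof.
have -> : (x + y) * (x + y) = (x * x + y * y) + (x * y + y * x).
  by rewrite mulrDl !mulrDr [y * x + _]addrC addrACA.
have -> : (x - y) * (x - y) = (x * x + y * y) - (x * y + y * x).
  by rewrite mulrBl !mulrBr opprB addrACA -opprD.
by rewrite opprB addrC addrA subrK.
Qed.

(* With [p = y + star y] and [q = i (y - star y)] one has
   [p ^ 2 + q ^ 2 = 2 (y star y + star y y)]. *)
Lemma npos_sum_starM y : npos (star y * y + y * star y).
Proof.
pose p := y + star y; pose q := 'i%C *: (y - star y).
have ps : star p = p by rewrite starD starK addrC.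
have qs : star q = q.
  rewrite starZc starB starK -[star y - y]opprB scalerN -scaleNr.
  by congr (_ *: _); simpc.
have pq := nposD (npos_sqr ps) (npos_sqr qs).
have e : p * p + q * q = (star y * y + y * star y) + (star y * y + y * star y).
  rewrite /q -scalerAl -scalerAr scalerA -(expr2 'i%C) sqr_i scaleN1r /p.
  rewrite [star y * y + _]addrC; exact: sub_sqrDB.
by rewrite -[X in npos X]scale_half -e; apply: nposZ => //; lra.
Qed.

(* Kelley--Vaught: for [h = star x * x] and [d] the square root of [h ^ 2], put
   [m = d - h] and [y = x m]; then [star y * y = m h m = - m d m] is negative,
   which forces [y = 0]. *)
Theorem npos_starM x : npos (star x * x).
Proof.
set h := star x * x; have hs : star h = h by rewrite starM starK.
have [d [dp dd dc]] := npos_sqrt (npos_sqr hs).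
have [ds _] := dp.
have hd : h * d = d * h by apply: dc; rewrite mulrA.
have [e [[es _] ee ec]] := npos_sqrt dp.
pose m := d - h.
have ms : star m = m by rewrite starB ds hs.
have md : m * d = d * m by rewrite mulrBl mulrBr hd.
have me : m * e = e * m by exact: ec.
(* Since h and d commute and d^2 = h^2, the product (d + h)(d - h) vanishes. *)
have hm : h * m = - (d * m).
  by apply/eqP; rewrite -addr_eq0 -mulrDl addrC (diff_squares_comm' hd) dd subrr.
pose y := x * m.
have yy : star y * y = - ((m * e) * (m * e)).
  rewrite /y starM ms -[LHS]mulrA (mulrA (star x)) -/h hm mulrN -ee; congr (- _).
  by rewrite -!mulrA me.
have mes : star (m * e) = m * e by rewrite starM ms es me.
have yn : npos (- (star y * y)) by rewrite yy opprK; exact: npos_sqr.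
(* Add the positive element [- (y * star y)] to the positive sum of both products. *)
have yp : npos (star y * y).
  rewrite -[X in npos X](addrK (y * star y)).
  exact: nposD (npos_sum_starM y) (npos_oppr_swap yn).
have me0 : m * e = 0.
  apply: sa_sqr_eq0 => //; apply/eqP; rewrite -oppr_eq0 -yy; apply/eqP.
  exact: npos_anti.
have dm : d * m = 0 by rewrite -md -ee mulrA me0 mul0r.
have m0 : m = 0.
  by apply: sa_sqr_eq0 => //; rewrite {1}/m mulrBl hm dm oppr0 subr0.
by rewrite -(subr0_eq m0).
Qed.

(** Each root b' is compared with the root d that commutes with everything commuting with its
    square. For x = b' - d, the positive elements b' x^2 and d x^2 have sum (b'^2 - d^2) x = 0, so
    both vanish and x^3 = 0. *)
Lemma npos_sqrt_unique b c : npos b -> npos c -> b * b = c * c -> b = c.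
Proof.
suff main d b' : npos d -> npos b' -> d * d = b' * b' ->
    (forall z, z * (b' * b') = b' * b' * z -> z * d = d * z) -> b' = d.
  move=> bp cp bc; have [bs _] := bp.
  have [d [dp dd dc]] := npos_sqrt (npos_sqr bs).
  by rewrite (main _ _ dp bp dd dc) (main _ _ dp cp) -?bc.
move=> dp bp dd dc; have [ds _] := dp; have [bs _] := bp.
have bd : b' * d = d * b' by apply: dc; rewrite mulrA.
set x := b' - d; have xs : star x = x by rewrite starB bs ds.
have bx : b' * x = x * b' by rewrite mulrBl mulrBr bd.
have dx : d * x = x * d by rewrite mulrBl mulrBr bd.
have cx k : k * x = x * k -> k * (x * x) = x * x * k.
  by move=> kx; rewrite mulrA kx -mulrA kx mulrA.
have bxp := npos_mul bp (npos_sqr xs) (cx _ bx).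
have dxp := npos_mul dp (npos_sqr xs) (cx _ dx).
have s0 : b' * (x * x) + d * (x * x) = 0.
  rewrite -mulrDl mulrA (diff_squares_comm' (esym bd)) dd subrr; exact: mul0r.
have b0 : b' * (x * x) = 0.
  by apply: npos_anti => //; rewrite -[X in npos X]add0r -s0 addrAC subrr add0r.
have d0 : d * (x * x) = 0 by rewrite -s0 b0 add0r.
have x3 : x * (x * x) = 0 by rewrite {1}/x mulrBl b0 d0 subrr.
apply: subr0_eq; apply: sa_sqr_eq0 => //; apply: sa_sqr_eq0.
  by rewrite starM xs.
by rewrite -mulrA x3 mulr0.
Qed.

Lemma cabs_sqrt a : npos (cabs a) /\ cabs a * cabs a = star a * a.
Proof.
rewrite /cabs /csqrt; case: xgetP => [b _ [bp <-]|].
  by split; [exact: positive_elt_npos|rewrite expr2].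
(* A positive root exists, so the default case of [xget] is contradictory. *)
have [d [dp dd _]] := npos_sqrt (npos_starM a).
by move=> /(_ d) []; split; [exact: npos_positive_elt|rewrite expr2].
Qed.

Lemma npos_cabs a : npos (cabs a). Proof. by have [] := cabs_sqrt a. Qed.

Lemma cabs_sqr a : cabs a * cabs a = star a * a.
Proof. by have [] := cabs_sqrt a. Qed.

(** By associativity [a] intertwines the two squares, hence also their roots, which uniqueness
    identifies with the moduli. *)
Lemma cabs_intertwine a : a * cabs a = cabs (star a) * a.
Proof.
have [d [d' [dp dp' dd dd' dc]]] := npos_sqrt2 (npos_starM a) (npos_starM (star a)).
have -> : cabs a = d by apply: npos_sqrt_unique; rewrite ?cabs_sqr//; exact: npos_cabs.
have -> : cabs (star a) = d'.
  by apply: npos_sqrt_unique; rewrite ?cabs_sqr//; exact: npos_cabs.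
by apply: dc; rewrite starK mulrA.
Qed.

End ModulusTheory.

(** * States are positive functionals *)

Section States.
Variables (R : realType) (A : cstarAlgType R).
Implicit Types (a b c d h k l q x y z : A) (s t : R) (f : {linear A -> R[i]^o}).
Local Notation scal := (scal A).
Local Notation Re := complex.Re.
Local Notation Im := complex.Im.
Local Notation normc := Normc.normc.

Lemma sqr_normcE (z : R[i]) : normc z ^+ 2 = Re z ^+ 2 + Im z ^+ 2.
Proof. by case: z => u v /=; rewrite sqr_sqrtr// addr_ge0// sqr_ge0. Qed.

Lemma normc_ge0 (z : R[i]) : 0 <= normc z.
Proof. by case: z => u v /=; exact: sqrtr_ge0. Qed.

Lemma state_norm f a : is_state f -> normc (f a) <= cnorm a.
Proof.
move=> [_ f1 fn].
(* An unbounded set has [sup] equal to 0, so the value 1 certifies boundedness. *)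
have hs : has_sup [set normc (f a) | a in [set a : A | cnorm a <= 1]].
  apply: contrapT => ns; move: fn; rewrite /functional_norm sup_out//.
  by move/eqP; rewrite eq_sym oner_eq0.
have a0 := cnorm_ge0 a; move: (a0); rewrite le_eqVlt => /orP[/eqP a00|a1].
  by rewrite (cnorm0_eq0 _ (esym a00)) linear0 Normc.normc0 cnorm0.
pose b := (cnorm a)^-1%:C *: a.
have : normc (f b) <= 1.
  rewrite -fn; apply: ub_le_sup; first by case: hs.
  exists b => //=; rewrite cnormZr gtr0_norm ?invr_gt0// mulVf// gt_eqF//.
rewrite linearZ /= Normc.normcM normc_real gtr0_norm ?invr_gt0//.
by rewrite mulrC ler_pdivrMr// mul1r.
Qed.

Lemma unital_scal f t : f 1 = 1 -> f (scal t) = t%:C.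
Proof. by move=> f1; rewrite !scalE linearZ /= f1 /GRing.scale /= mulr1. Qed.

(* If [v = Im (f h)] were nonzero then [|f (h + i s)|] would exceed
   [cnorm (h + i s)] for a suitable real [s]. *)
Lemma state_sa_real f h : is_state f -> star h = h -> Im (f h) = 0.
Proof.
move=> fs hs; have [_ f1 _] := fs.
pose u := Re (f h); pose v := Im (f h); pose N := cnorm h.
have key s : u ^+ 2 + (v + s) ^+ 2 <= N ^+ 2 + s ^+ 2.
  pose x := h + 'i%C *: scal s.
  have fx : normc (f x) ^+ 2 = u ^+ 2 + (v + s) ^+ 2.
    rewrite /x linearD linearZ /= unital_scal// sqr_normcE /u /v.
    by case: (f h) => p q /=; congr (_ ^+ 2 + _ ^+ 2); ring.
  rewrite -fx; have xs : star x = h - 'i%C *: scal s.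
    by rewrite starD starZc hs star_scal -scaleNr; congr (_ + _ *: _); simpc.
  apply: (@le_trans _ _ (cnorm x ^+ 2)).
    by rewrite ler_pXn2r ?nnegrE ?cnorm_ge0 ?normc_ge0//; exact: state_norm.
  rewrite -cnorm_starM xs diff_squares_comm; last first.
    by rewrite -scalerAl -scalerAr scalC.
  rewrite -scalerAl -scalerAr scalerA -(expr2 'i%C) sqr_i scaleN1r opprK -scalM.
  apply: le_trans (cnormD _ _) _; rewrite cnorm_sqr_sa// cnorm_scal -expr2.
  by rewrite ger0_norm ?sqr_ge0.
apply/eqP; apply: contraT => v0; rewrite -/v in v0.
(* With this s, v^2 + 2 v s = N^2 + 1, whereas [key] gives u^2 + v^2 + 2 v s <= N^2. *)
have := key ((N ^+ 2 + 1 - v ^+ 2) / (2 * v)).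
set s := _ / _; have es : 2 * v * s = N ^+ 2 + 1 - v ^+ 2.
  by rewrite mulrC /s divfK// mulf_neq0// pnatr_eq0.
have := sqr_ge0 u; nra.
Qed.

(** As f h is real, |t - f h| <= ||t - h|| <= t leaves only f h >= 0. *)
Lemma state_npos f h : is_state f -> npos h -> 0 <= f h.
Proof.
move=> fs hp; have [hs [t ht]] := hp; have [_ f1 _] := fs.
have im0 := state_sa_real fs hs.
have := le_trans (state_norm (scal t - h) fs) ht.
rewrite linearB /= unital_scal// lecE im0 eqxx /=.
rewrite (_ : t%:C - f h = (t - Re (f h))%:C); last first.
  by move: im0; case: (f h) => p q /= ->; simpc.
by rewrite normc_real ler_norml => /andP[_]; lra.
Qed.

End States.

(** * Inequalities for positive functionals *)

Section PositiveFunctionals.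
Variables (R : realType) (A : cstarAlgType R) (f : {linear A -> R[i]^o}).
Hypothesis f_npos : forall h : A, npos h -> 0 <= f h.
Implicit Types (a b c d h k l q x y z : A) (s t : R).
Local Notation scal := (scal A).
Local Notation Re := complex.Re.
Local Notation Im := complex.Im.
Local Notation normc := Normc.normc.

Lemma pos_Re_ge0 h : npos h -> 0 <= Re (f h).
Proof. by move=> /f_npos; rewrite lecE => /andP[]. Qed.

Lemma pos_Re h : npos h -> f h = (Re (f h))%:C.
Proof. by move=> /f_npos/ger0_Im; case: (f h) => u v /= ->. Qed.

(** h is the difference of the positive elements ||h|| and ||h|| - h. *)
Lemma pos_sa_Im h : star h = h -> Im (f h) = 0.
Proof.
move=> hs; have := pos_Re (npos_sa hs (lexx _)); have := f_npos (npos_scal A (cnorm_ge0 h)).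
move/ger0_Im; rewrite linearB /=; case: (f (scal _)) => u v /= ->.
by case: (f h) => u' v' /= []; rewrite sub0r => /eqP; rewrite oppr_eq0 => /eqP.
Qed.

Lemma pos_star a : f (star a) = conjc (f a).
Proof.
have h1 : Im (f (a + star a)) = 0 by apply: pos_sa_Im; rewrite starD starK addrC.
have h2 : Im (f ('i%C *: (a - star a))) = 0.
  apply: pos_sa_Im; rewrite starZc starB starK -[star a - a]opprB scalerN -scaleNr.
  by congr (_ *: _); simpc.
move: h1 h2; rewrite linearD linearZ linearB /= /GRing.scale /=.
case: (f a) => u v; case: (f (star a)) => u' v' /= h1 h2.
by congr Complex; lra.
Qed.

(** For P > 0 evaluate at s = -1/P. For P = 0 and N > 0 the value s = -(Q + 1)/(2N) would make the
    expression -1. *)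
Lemma quad_discr (N P Q : R) : 0 <= N -> 0 <= P ->
  (forall s, 0 <= s ^+ 2 * (N * P) + 2 * s * N + Q) -> N <= P * Q.
Proof.
move=> N0; rewrite le_eqVlt => /orP[/eqP <-|P0] h.
  rewrite mul0r; case: (leP N 0) => // Np.
  have := h (- (Q + 1) / (2 * N)).
  rewrite mulr0 mulr0 add0r.
  have -> : 2 * (- (Q + 1) / (2 * N)) * N = - (Q + 1) by field; rewrite gt_eqF.
  lra.
have := h (- P^-1).
have -> : (- P^-1) ^+ 2 * (N * P) + 2 * - P^-1 * N + Q = (P * Q - N) / P.
  by field; rewrite gt_eqF.
by rewrite pmulr_lge0 ?invr_gt0// subr_ge0.
Qed.

(** With w = f (x y), positivity of f at [star z * z] for z = s w [star x] + y gives a quadratic in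
    s; the factor w replaces a choice of phase. *)
Lemma pos_cauchy_schwarz x y :
  normc (f (x * y)) ^+ 2 <= Re (f (x * star x)) * Re (f (star y * y)).
Proof.
set w := f (x * y).
have xp : npos (x * star x) by rewrite -{1}(starK x); exact: npos_starM.
rewrite sqr_normcE; apply: quad_discr => [||s]; first by rewrite addr_ge0 ?sqr_ge0.
  exact: pos_Re_ge0.
have fs : f (star y * star x) = conjc w by rewrite -starM pos_star.
have := pos_Re_ge0 (npos_starM ((s%:C * w) *: star x + y)).
rewrite starD starZc starK mulrDl !mulrDr -!scalerAl -!scalerAr scalerA.
rewrite !linearD !linearZ /= -/w fs (pos_Re xp) /GRing.scale /=.
congr (0 <= _); clear; case: w => u v /=.
ring.
Qed.

Hypothesis f1 : f 1 = 1.

(* With [g ^ 2 = |a| + e], Cauchy--Schwarz is applied to [a = (a g^-1) g], where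
   [a g^-2 star a = (|a*| + e)^-1 |a*|^2 <= |a*|]. *)
Lemma mixed_schwarz a :
  normc (f a) ^+ 2 <= Re (f (cabs a)) * Re (f (cabs (star a))).
Proof.
set b := cabs a; set c := cabs (star a).
have bp : npos b := npos_cabs a; have cp : npos c := npos_cabs (star a).
have B0 := pos_Re_ge0 bp; have C0 := pos_Re_ge0 cp.
suff main e : 0 < e -> normc (f a) ^+ 2 <= Re (f c) * (Re (f b) + e).
  apply/ler_addgt0Pr => e e0.
  (* The denominator f c + 1 is positive even if f c = 0, and the resulting error is at most e. *)
  have C1 : 0 < Re (f c) + 1 by lra.
  have d0 : 0 < e / (Re (f c) + 1) by rewrite divr_gt0.
  apply: le_trans (main _ d0) _; rewrite mulrDr [X in _ <= X + _]mulrC lerD2l mulrA.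
  by rewrite ler_pdivrMr// mulrDr mulr1 [e * _]mulrC lerDl ltW.
move=> e0.
have bep : npos (b + scal e) by apply: nposD => //; exact: npos_scal (ltW e0).
have [g [[gs _] gg _]] := npos_sqrt bep.
have [k [gk kg]] : invertible g.
  by apply: (@invertible_comm_mul _ _ _ g) => //; rewrite gg; exact: npos_invertible.
have ks := npos_star_inv gs gk kg.
have [l [cl lc]] := npos_invertible cp e0.
have cep : npos (c + scal e) by apply: nposD => //; exact: npos_scal (ltW e0).
have ls := npos_star_inv (npos_star cep) cl lc.
have lp : npos l.
  have -> : l = (c + scal e) * (l * l) by rewrite mulrA cl mul1r.
  apply: npos_mul => //; first exact: npos_sqr.
  by rewrite mulrA cl -mulrA lc mul1r mulr1.
have lcc : l * c = c * l.
  have : l * (c + scal e) = (c + scal e) * l by rewrite lc cl.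
  by rewrite mulrDr mulrDl scalC => /addIr.
(* Multiply a g^2 = (c + e) a by l on the left and by k^2 on the right. *)
have akk : a * (k * k) = l * a.
  have e1 : a * (g * g) = (c + scal e) * a.
    by rewrite gg mulrDr mulrDl scalC cabs_intertwine.
  have : l * (a * (g * g)) * (k * k) = l * a * (g * g * (k * k)) by rewrite !mulrA.
  rewrite e1 (mulrA l) lc mul1r => ->.
  by rewrite -[g * g * _]mulrA (mulrA g k) gk mul1r gk mulr1.
have aE : (a * k) * g = a by rewrite -mulrA kg mulr1.
have := pos_cauchy_schwarz (a * k) g; rewrite aE gs gg linearD /= unital_scal//.
have -> : Re (f b + e%:C) = Re (f b) + e by case: (f b).
move/le_trans; apply; apply: ler_wpM2r; first by rewrite addr_ge0// ltW.
have -> : a * k * star (a * k) = l * (c * c).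
  by rewrite starM ks [LHS]mulrA -(mulrA a) akk -mulrA cabs_sqr starK.
have : npos (e%:C *: (l * c)) by apply: nposZ (ltW e0) _; exact: npos_mul.
(* From l (c + e) = 1 follows c = l (c + e) c, so the gap is e l c. *)
have -> : e%:C *: (l * c) = c - l * (c * c).
  rewrite -{2}(mul1r c) -lc -mulrA mulrDl mulrDr addrC addKr scal_mull.
  by rewrite -scalerAr.
by move/pos_Re_ge0; rewrite linearB /=; case: (f c) (f _) => u v [u' v'] /=; rewrite subr_ge0.
Qed.

(* [(b - m) (b ^ n - m ^ n) >= 0] for [m = f b]. *)
Lemma pos_expr_step b n : npos b ->
  Re (f b) * Re (f (b ^+ n)) <= Re (f (b ^+ n.+1)).
Proof.
move=> bp; set m := Re (f b); have m0 : 0 <= m := pos_Re_ge0 bp.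
have [bs _] := bp.
have cb : GRing.comm b (scal m) by exact: esym (scalC _ _).
(* The cofactor in b^n - m^n = (b - m) S. Its terms are products of commuting positive elements, so
   (b - m)^2 S is positive. *)
pose S : A := \sum_(i < n) b ^+ (n.-1 - i) * scal m ^+ i.
have scalX j : scal m ^+ j = scal (m ^+ j).
  by elim: j => [|j IH]; rewrite ?expr0 ?scal1// !exprS IH scalM.
have Sp : npos S.
  apply: npos_sum => i _; apply: npos_mul; first exact: npos_exp.
    by rewrite scalX; apply: npos_scal; exact: exprn_ge0.
  by rewrite scalX scalC.
have e : b ^+ n - scal m ^+ n = (b - scal m) * S by rewrite subrXX_comm.
have bmS : (b - scal m) * (b - scal m) * S = S * ((b - scal m) * (b - scal m)).
  have c1 : GRing.comm (b - scal m) S.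
    rewrite /S; apply: commr_sum => i _; apply: commrM; apply: commrX.
      by rewrite /GRing.comm mulrBl mulrBr scalC.
    by rewrite /GRing.comm scalC.
  by rewrite -mulrA c1 mulrA c1 mulrA.
have sp : npos ((b - scal m) * (b - scal m)).
  by apply: npos_sqr; rewrite starB bs star_scal.
have := pos_Re_ge0 (npos_mul sp Sp bmS).
(* After expansion the terms m^n f b and m^(n+1) cancel because f b = m. *)
rewrite -mulrA -e mulrBl !mulrBr -exprS scalX -scalM.
rewrite scal_mulr scal_mull !linearB /= unital_scal// !linearZ /GRing.scale /=
  (pos_Re (npos_exp n bp)).
rewrite (pos_Re bp) -/m (pos_Re (npos_exp n.+1 bp)) /= /GRing.scale /=.
lra.
Qed.

Lemma pos_expr b n : npos b -> Re (f b) ^+ n <= Re (f (b ^+ n)).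
Proof.
move=> bp; elim: n => [|n IH]; first by rewrite !expr0 f1.
rewrite exprS; apply: le_trans (pos_expr_step n bp).
by apply: ler_wpM2l IH; exact: pos_Re_ge0.
Qed.

Lemma pos_sqr x : star x = x -> Re (f x) ^+ 2 <= Re (f (x * x)).
Proof.
move=> xs; have := pos_cauchy_schwarz 1 x.
rewrite mul1r star1 mulr1 f1 xs /= mul1r sqr_normcE; apply: le_trans.
by rewrite lerDl sqr_ge0.
Qed.

Theorem pos_expr_cabs a r :
  normc (f a) ^+ (2 * r) <=
  4^-1 * Re (f ((cabs a ^+ r + cabs (star a) ^+ r) * (cabs a ^+ r + cabs (star a) ^+ r))).
Proof.
set p := cabs a ^+ r; set q := cabs (star a) ^+ r.
have pp : npos p by exact/npos_exp/npos_cabs.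
have qp : npos q by exact/npos_exp/npos_cabs.
have [sps _] := nposD pp qp.
have h1 := pos_sqr sps.
have hb := pos_expr r (npos_cabs a); have hc := pos_expr r (npos_cabs (star a)).
have B0 := exprn_ge0 r (pos_Re_ge0 (npos_cabs a)).
have C0 := exprn_ge0 r (pos_Re_ge0 (npos_cabs (star a))).
have : normc (f a) ^+ (2 * r) <= Re (f (cabs a)) ^+ r * Re (f (cabs (star a))) ^+ r.
  rewrite exprM -exprMn; apply: lerXn2r; rewrite ?nnegrE ?sqr_ge0//.
    by apply: mulr_ge0; exact/pos_Re_ge0/npos_cabs.
  exact: mixed_schwarz.
move/le_trans; apply; rewrite -/p in hb; rewrite -/q in hc.
have := ler_pM B0 C0 hb hc.
move: h1; have -> : Re (f (p + q)) = Re (f p) + Re (f q).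
  by rewrite linearD /=; case: (f p) (f q) => ? ? [].
(* This square yields 4 f p f q <= (f p + f q)^2. *)
have := sqr_ge0 (Re (f p) - Re (f q)).
lra.
Qed.

End PositiveFunctionals.

(** * Power mean inequality for nonnegative reals *)

Section PowerMean.
Variable R : realType.
Implicit Types (x c : R).

Lemma subr_mul_subrX_ge0 x c k : 0 <= x -> 0 <= c -> 0 <= (x - c) * (x ^+ k - c ^+ k).
Proof.
move=> x0 c0; rewrite subrXX mulrA -expr2; apply: mulr_ge0; first exact: sqr_ge0.
by apply: sumr_ge0 => i _; rewrite mulr_ge0 ?exprn_ge0.
Qed.

(** For the mean c, the sum of (x_k - c)(x_k^j - c^j) is nonnegative and its part with c^j vanishes.
    This raises the exponent by one at the cost of a factor n; induction repeats it. *)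
Lemma power_mean n (x : 'I_n -> R) m : (0 < n)%N -> (forall k, 0 <= x k) ->
  (\sum_k x k) ^+ m.+1 <= n%:R ^+ m * \sum_k x k ^+ m.+1.
Proof.
move=> n0 x0; have nR0 : 0 < n%:R :> R by rewrite ltr0n.
have S0 : 0 <= \sum_k x k by exact: sumr_ge0.
have step j : (\sum_k x k) * (\sum_k x k ^+ j) <= n%:R * \sum_k x k ^+ j.+1.
  have [c c0 cn] : exists2 c, 0 <= c & n%:R * c = \sum_k x k.
    exists ((\sum_k x k) / n%:R); first by rewrite divr_ge0// ltW.
    by rewrite mulrC divfK// gt_eqF.
  rewrite -{1}cn -mulrA ler_wpM2l ?ler0n// -subr_ge0.
  have : 0 <= \sum_k (x k - c) * (x k ^+ j - c ^+ j).
    by apply: sumr_ge0 => k _; exact: subr_mul_subrX_ge0.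
  under eq_bigr do rewrite mulrBr !mulrBl -exprS.
  rewrite !sumrB -!mulr_suml -!mulr_sumr sumr_const card_ord -[c *+ n]mulr_natl cn.
  by rewrite subrr subr0.
elim: m => [|m IH]; first by rewrite expr0 expr1 mul1r; under [leRHS]eq_bigr do rewrite expr1.
rewrite [leLHS]exprS; apply: le_trans (ler_wpM2l S0 IH) _.
by rewrite mulrCA exprSr -mulrA ler_wpM2l// exprn_ge0// ltW.
Qed.

End PowerMean.

(** * From single states to the numerical radius *)

Section NumericalRadius.
Variables (R : realType) (A : cstarAlgType R).
Implicit Types (a b : A) (f : {linear A -> R[i]^o}).
Local Notation Re := complex.Re.
Local Notation normc := Normc.normc.

Lemma Re_le_normc (z : R[i]) : Re z <= normc z.
Proof. by rewrite -lecR; apply: le_trans (normc_ge_Re z); rewrite lecR ler_norm. Qed.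

Lemma normc_sum n (z : 'I_n -> R[i]) : normc (\sum_k z k) <= \sum_k normc (z k).
Proof.
rewrite -lecR rmorph_sum; exact: (ler_norm_sum _ z).
Qed.

Lemma complex_invr2 : 2^-1 = (2^-1)%:C :> R[i].
Proof. by rewrite fmorphV rmorph_nat. Qed.

(** Half the square of |a|^r + |[star a]|^r, expanded as in the bound to be proved. *)
Definition sqr_mean a r : A :=
  2^-1 *: (cabs a ^+ (2 * r) + cabs (star a) ^+ (2 * r))
    + cre (cabs a ^+ r * cabs (star a) ^+ r).

Lemma sqr_meanE a r (s := cabs a ^+ r + cabs (star a) ^+ r) :
  sqr_mean a r = 2^-1%:C *: (s * s) /\ npos (sqr_mean a r).
Proof.
have [ps _] := npos_exp r (npos_cabs a).
have [qs _] := npos_exp r (npos_cabs (star a)).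
have e : sqr_mean a r = 2^-1%:C *: (s * s).
  rewrite /sqr_mean /cre complex_invr2 -scalerDr starM ps qs mulnC !exprM !expr2.
  congr (_ *: _); rewrite /s mulrDl !mulrDr.
  by rewrite addrACA [X in _ + X]addrC.
split=> //; rewrite e; apply: nposZ; first lra.
by apply: npos_sqr; rewrite starD ps qs.
Qed.

Lemma state_sum_pow n (a : 'I_n -> A) f r : (0 < n)%N -> is_state f -> (0 < r)%N ->
  normc (f (\sum_k a k)) ^+ (2 * r) <=
  n%:R ^+ (2 * r - 1) / 2 * Re (f (\sum_k sqr_mean (a k) r)).
Proof.
move=> n0 fs r0; have [_ f1 _] := fs; have fp h := state_npos fs (h := h).
rewrite !linear_sum /=.
(* Writing 2r = m + 1 makes the factor n^m of the power mean inequality equal to n^(2r-1). *)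
have [m em] : exists m, (2 * r = m.+1)%N by exists (2 * r).-1; rewrite prednK// muln_gt0.
have le1 : normc (\sum_k f (a k)) ^+ (2 * r) <= (\sum_k normc (f (a k))) ^+ (2 * r).
  by apply: lerXn2r; rewrite ?nnegrE ?normc_ge0 ?normc_sum ?sumr_ge0// => k _; exact: normc_ge0.
apply: le_trans le1 _; rewrite em; apply: le_trans (power_mean m n0 _) _.
  by move=> k; exact: normc_ge0.
rewrite subn1 /= -mulrA ler_wpM2l ?exprn_ge0 ?ler0n// mulr_sumr.
apply: ler_sum => k _; rewrite -em; apply: le_trans (pos_expr_cabs fp f1 _ _) _.
have [-> _] := sqr_meanE (a k) r.
rewrite linearZ /= /GRing.scale /=; case: (f _) => u v /=; rewrite mul0r subr0.
lra.
Qed.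

Lemma numerical_radius_pow_le a m B : (0 < m)%N -> 0 <= B ->
  (forall f, is_state f -> normc (f a) ^+ m <= B) -> numerical_radius a ^+ m <= B.
Proof.
move=> m0 B0 h; rewrite /numerical_radius; set S := [set _ | _ in _].
(* The m-th root of B bounds all |f a|. *)
pose c := B `^ (m%:R^-1).
have c0 : 0 <= c := powR_ge0 _ _.
have cB : c ^+ m = B.
  by rewrite -powR_mulrn// -powRrM mulVf ?powRr1// pnatr_eq0 -lt0n.
have ubS : ubound S c.
  move=> _ [f fs <-]; rewrite -(ler_pXn2r m0) ?nnegrE ?normc_ge0//.
  by rewrite cB; exact: h.
(* An empty set has supremum 0; otherwise a member y shows that the supremum is nonnegative, as
   monotonicity of the power requires. *)
have [S0|/set0P[y Sy]] := eqVneq S set0.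
  by rewrite S0 sup0 expr0n gtn_eqF.
rewrite -cB; apply: lerXn2r; rewrite ?nnegrE//; last by apply: ge_sup => //; exists y.
have y0 : 0 <= y by case: Sy => f _ <-; exact: normc_ge0.
by apply: le_trans y0 _; apply: ub_le_sup => //; exists c.
Qed.

Lemma numerical_radius_sum_pow n (a : 'I_n -> A) r : (0 < n)%N -> (0 < r)%N ->
  numerical_radius (\sum_k a k) ^+ (2 * r) <=
  n%:R ^+ (2 * r - 1) / 2 *
    (cnorm (\sum_k cre (cabs (a k) ^+ r * cabs (star (a k)) ^+ r))
     + 2^-1 * cnorm (\sum_k (cabs (a k) ^+ (2 * r) + cabs (star (a k)) ^+ (2 * r)))).
Proof.
move=> n0 r0; set X := \sum_k cre _; set Y := \sum_k (_ + _).
have c0 : 0 <= n%:R ^+ (2 * r - 1) / 2 :> R.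
  by rewrite divr_ge0// exprn_ge0.
apply: numerical_radius_pow_le; first by rewrite muln_gt0.
  by rewrite mulr_ge0// addr_ge0 ?mulr_ge0 ?cnorm_ge0.
move=> f fs; apply: le_trans (state_sum_pow a n0 fs r0) _; apply: ler_wpM2l => //.
rewrite /sqr_mean big_split /= -scaler_sumr -/X -/Y.
apply: le_trans (Re_le_normc _) _; apply: le_trans (state_norm _ fs) _.
rewrite addrC; apply: le_trans (cnormD _ _) _; rewrite lerD2l.
by rewrite complex_invr2 cnormZr ger0_norm.
Qed.

End NumericalRadius.

Local Close Scope complex_scope.
Local Close Scope classical_set_scope.

Theorem theorem4p2 (R : realType) (A : cstarAlgType R) :
  (forall (n : nat) (a : 'I_n -> A) (f : {linear A -> R[i]^o}) (r : nat),
      (0 < n)%N -> is_state f -> (0 < r)%N ->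
      `|f (\sum_(k < n) a k)| ^+ (2 * r) <=
        n%:R ^+ (2 * r - 1) / 2 *
        f (\sum_(k < n)
             2^-1 *: (cabs (a k) ^+ (2 * r) + cabs (star (a k)) ^+ (2 * r))
           + \sum_(k < n) cre (cabs (a k) ^+ r * cabs (star (a k)) ^+ r)))
  /\
  (forall (n : nat) (a : 'I_n -> A) (r : nat),
      (0 < n)%N -> (0 < r)%N ->
      numerical_radius (\sum_(k < n) a k) ^+ (2 * r) <=
        n%:R ^+ (2 * r - 1) / 2 *
        (cnorm (\sum_(k < n) cre (cabs (a k) ^+ r * cabs (star (a k)) ^+ r))
         + 2^-1 * cnorm (\sum_(k < n) (cabs (a k) ^+ (2 * r)
                                       + cabs (star (a k)) ^+ (2 * r)))))
  /\
  (forall (a : A) (r : nat),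
      (0 < r)%N ->
      numerical_radius a ^+ (2 * r) <=
        2^-1 * cnorm (cre (cabs a ^+ r * cabs (star a) ^+ r))
        + 4^-1 * cnorm (cabs a ^+ (2 * r) + cabs (star a) ^+ (2 * r))).
Proof.
split=> [n a f r n0 fs r0|]; last split=> [n a r n0 r0|a r r0].
(* Positivity makes the value of f real, so the complex inequality reduces to the real one. *)
- have T : npos (\sum_(k < n) sqr_mean (a k) r).
    by apply: npos_sum => k _; have [] := sqr_meanE (a k) r.
  rewrite -big_split [X in _ * X](pos_Re (fun h => state_npos fs (h := h)) T).
  have := state_sum_pow a n0 fs r0; rewrite -lecR [leLHS]rmorphXn.
  by rewrite !rmorphM rmorphXn rmorph_nat fmorphV rmorph_nat.
- exact: numerical_radius_sum_pow.
- have := numerical_radius_sum_pow (fun _ : 'I_1 => a) isT r0.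
  rewrite !big_ord1 expr1n mulrDr !mul1r mulrA (_ : 2^-1 * 2^-1 = 4^-1)//.
  by rewrite -invfM -natrM.
Qed.
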